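(* Let $a,b,c>0$ and $r\in(0,1)$. Then the function $g(p)=F(a,b;c;r^{p})^{1/p}$ is decreasing in $p\in(0,\infty)$. In particular, for $p\ge 1$: (1) for $a,b,c>0$ and $r\in(0,1)$, $$F(a,b;c;r^{p})^{1/p}\le F(a,b;c;r)\le F(a,b;c;r^{1/p})^{p};$$ (2) for $a\in(0,1/2]$ and $r\in(0,1)$, $$\left(\frac{\pi}{2}\right)^{1-1/p}\mathcal{K}_a(r^{p})^{1/p}\le \mathcal{K}_a(r)\le \left(\frac{\pi}{2}\right)^{1-p}\mathcal{K}_a(r^{1/p})^{p};$$ (3) for $a\in(0,1/2]$ and $r\in(0,1)$, $$\left(\frac{\pi}{2}\right)^{1-p}\mathcal{E}_a(r^{1/p})^{p}\le \mathcal{E}_a(r)\le \left(\frac{\pi}{2}\right)^{1-1/p}\mathcal{E}_a(r^{p})^{1/p}.$$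
   Context: $F(a,b;c;z)=\sum_{n=0}^\infty \frac{(a,n)(b,n)}{(c,n)}\frac{z^n}{n!}$ for $|z|<1$ is the Gaussian hypergeometric function, where $(a,0)=1$ and $(a,n)=a(a+1)\cdots(a+n-1)$ for $n\ge 1$. For $a\in(0,1/2]$ and $r\in(0,1)$, the generalized elliptic integrals are $\mathcal{K}_a(r)=\frac{\pi}{2}F(a,1-a;1;r^2)$ and $\mathcal{E}_a(r)=\frac{\pi}{2}F(a-1,1-a;1;r^2)$. *)

(* Defs.v *)
From Stdlib Require Import Reals Factorial.
From Coquelicot Require Import Coquelicot.
Open Scope R_scope.

(* Shifted factorial (a,n) = a (a+1) ... (a+n-1). *)
Fixpoint shifted_fact (a : R) (n : nat) : R :=
  match n with
  | O => 1
  | S m => shifted_fact a m * (a + INR m)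
  end.

(* Gaussian hypergeometric function F(a,b;c;z) at real arguments. Meaningful
   for |z| < 1 and c not in {0,-1,-2,...}; elsewhere the value is whatever
   Coquelicot's total [Series] returns. *)
Definition hyperF (a b c z : R) : R :=
  Series (fun n => shifted_fact a n * shifted_fact b n / shifted_fact c n
                   * (z ^ n / INR (fact n))).

Definition ellK (a r : R) : R := PI / 2 * hyperF a (1 - a) 1 (r ^ 2).

Definition ellE (a r : R) : R := PI / 2 * hyperF (a - 1) (1 - a) 1 (r ^ 2).

(* Main.v *)
Require Import Defs.
From Stdlib Require Import Reals Lra Factorial.
From Coquelicot Require Import Coquelicot.
Open Scope R_scope.

(** Write [x = r^p] and [t = q/p > 1].  If [H] is increasing with values
    above [1] on [(0,1)], then [x^t < x] gives [H (x^t) < H x < (H x)^t], and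
    the [q]-th root of this chain is the asserted monotonicity
    ([root_of_power_decreasing]).

    For [F(a,b;c;.)] with positive parameters both properties hold because all
    Taylor coefficients are positive and the constant one is [1]
    ([hyperF_increasing], [hyperF_gt_1]); [K_a] follows at the point [r^2].

    For [E_a] the relevant function is [G = F(-s,s;1;.)] with [s = 1-a], whose
    coefficients after the constant one are all negative, so [G] decreases from
    [G(0) = 1].  The same argument runs for [1/G], which reverses the
    inequalities, once [G > 0] is known.  Positivity comes from the closed form
    of the partial sums of the coefficients ([sum_hyper_coef_opp]): they stay
    positive, so the negative coefficients have total mass at most [1] and
    [G x >= 1 - x] ([hyperF_opp_lower_bound]). *)

(** * Roots of values at powers *)

Lemma Rpower_inside_unit (r p : R) :
  0 < r < 1 -> 0 < p -> 0 < Rpower r p < 1.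
Proof.
  intros Hr Hp; split; [apply exp_pos|].
  unfold Rpower; rewrite <- exp_0; apply exp_increasing.
  assert (ln r < 0) by (rewrite <- ln_1; apply ln_increasing; lra).
  nra.
Qed.

Lemma Rpower_decreasing_exponent (r p q : R) :
  0 < r < 1 -> p < q -> Rpower r q < Rpower r p.
Proof.
  intros Hr Hpq.
  unfold Rpower; apply exp_increasing.
  assert (ln r < 0) by (rewrite <- ln_1; apply ln_increasing; lra).
  nra.
Qed.

Lemma Rpower_inv_base (x y : R) : 0 < x -> Rpower (/ x) y = / Rpower x y.
Proof.
  intros Hx; unfold Rpower; rewrite ln_Rinv by assumption.
  rewrite <- exp_Ropp; f_equal; ring.
Qed.

Lemma Rinv_le_cancel_pos (x y : R) : 0 < x -> 0 < y -> / y <= / x -> x <= y.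
Proof.
  intros Hx Hy Hle; rewrite <- (Rinv_inv x), <- (Rinv_inv y).
  apply Rinv_le_contravar; [now apply Rinv_0_lt_compat|assumption].
Qed.

Lemma Rpower_sqr_comm (r p : R) : 0 < r -> Rpower r p ^ 2 = Rpower (r ^ 2) p.
Proof.
  intros Hr; simpl; rewrite !Rmult_1_r; apply Rpower_mult_distr; assumption.
Qed.

(** The weight [k^(1-s)] is what makes the normalisation [k H] of a function
    scale linearly under the exponent [s]. *)
Lemma Rpower_normalized (k y s : R) :
  0 < k -> 0 < y -> Rpower k (1 - s) * Rpower (k * y) s = k * Rpower y s.
Proof.
  intros Hk Hy.
  rewrite <- Rpower_mult_distr by assumption.
  rewrite <- Rmult_assoc, <- Rpower_plus.
  replace (1 - s + s) with 1 by ring.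
  now rewrite Rpower_1.
Qed.

(** Replacing [r^q] by the larger [r^p] increases the value, and since that
    value exceeds [1], replacing the exponent [1/q] by [1/p] increases it
    again. *)
Lemma root_of_power_decreasing (H : R -> R) :
  (forall x, 0 < x < 1 -> 1 < H x) ->
  (forall x y, 0 < x -> x < y -> y < 1 -> H x < H y) ->
  forall r p q, 0 < r < 1 -> 0 < p -> p < q ->
    Rpower (H (Rpower r q)) (1 / q) < Rpower (H (Rpower r p)) (1 / p).
Proof.
  intros H1 Hincr r p q Hr Hp Hpq.
  assert (Hq : 0 < q) by lra.
  destruct (Rpower_inside_unit r p Hr Hp) as [Hp0 Hp1].
  destruct (Rpower_inside_unit r q Hr Hq) as [Hq0 Hq1].
  assert (Hlt := Rpower_decreasing_exponent r p q Hr Hpq).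
  assert (Hinv : 1 / q < 1 / p).
  { unfold Rdiv; rewrite !Rmult_1_l; apply Rinv_lt_contravar; [nra|lra]. }
  assert (Hq' : 0 < 1 / q) by (apply Rdiv_lt_0_compat; lra).
  apply Rlt_trans with (Rpower (H (Rpower r p)) (1 / q)).
  - apply Rlt_Rpower_l; [assumption|].
    specialize (H1 (Rpower r q) (conj Hq0 Hq1)).
    specialize (Hincr _ _ Hq0 Hlt Hp1); lra.
  - apply Rpower_lt; [apply H1; lra|assumption].
Qed.

(** Both bounds are the monotonicity in the exponent, between [1] and [p] for
    the left one and between [1/p] and [1] for the right one. *)
Lemma root_of_power_bounds (H : R -> R) :
  (forall x, 0 < x < 1 -> 1 < H x) ->
  (forall x y, 0 < x -> x < y -> y < 1 -> H x < H y) ->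
  forall r p, 0 < r < 1 -> 1 <= p ->
    Rpower (H (Rpower r p)) (1 / p) <= H r
    /\ H r <= Rpower (H (Rpower r (1 / p))) p.
Proof.
  intros H1 Hincr r p Hr Hp.
  assert (Hr1 : Rpower r 1 = r) by (apply Rpower_1; lra).
  assert (HH1 : Rpower (H r) 1 = H r).
  { apply Rpower_1; specialize (H1 r Hr); lra. }
  destruct (Req_dec p 1) as [->|Hne].
  - replace (1 / 1) with 1 by field.
    rewrite Hr1, HH1; lra.
  - assert (Hp' : 1 < p) by lra.
    assert (Hi : 0 < 1 / p) by (apply Rdiv_lt_0_compat; lra).
    assert (Hi1 : 1 / p < 1).
    { apply Rmult_lt_reg_r with p; [lra|]; field_simplify; lra. }
    split.
    + pose proof (root_of_power_decreasing H H1 Hincr r 1 p Hr Rlt_0_1 Hp') as L.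
      replace (1 / 1) with 1 in L by field.
      rewrite Hr1, HH1 in L; lra.
    + pose proof (root_of_power_decreasing H H1 Hincr r (1 / p) 1 Hr Hi Hi1) as L.
      replace (1 / 1) with 1 in L by field.
      replace (1 / (1 / p)) with p in L by (field; lra).
      rewrite Hr1, HH1 in L; lra.
Qed.

(** * Power series with nonnegative coefficients *)

Lemma PSeries_nondecreasing (u : nat -> R) (x y : R) :
  (forall n, 0 <= u n) -> 0 <= x <= y -> ex_pseries u y ->
  PSeries u x <= PSeries u y.
Proof.
  intros Hu Hxy Hex; unfold PSeries; apply Series_le.
  - intros n; split.
    + apply Rmult_le_pos; [apply Hu|apply pow_le; lra].
    + apply Rmult_le_compat_l; [apply Hu|apply pow_incr; lra].
  - now apply ex_pseries_R.
Qed.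

(** With [P] the series of the shifted coefficients, the value at [x] is
    [u 0 + x P(x)], where [P(y) >= P(x)] and [P(y) >= P(0) = u 1 > 0].  Only the
    coefficients from index [1] on are asked to be nonnegative, so that the
    lemma also covers [-F(-s,s;1;.)], whose constant coefficient is [-1]. *)
Lemma PSeries_increasing (u : nat -> R) (x y : R) :
  (forall n, 0 <= u (S n)) -> 0 < u 1%nat -> 0 <= x < y ->
  ex_pseries u x -> ex_pseries u y ->
  PSeries u x < PSeries u y.
Proof.
  intros Hu Hu1 Hxy Hx Hy.
  rewrite (PSeries_decr_1 u x Hx), (PSeries_decr_1 u y Hy).
  assert (Hy' : ex_pseries (PS_decr_1 u) y).
  { apply ex_pseries_decr_1; [|assumption].
    right; exists (/ y); apply Rinv_l; lra. }
  assert (Hxy' : PSeries (PS_decr_1 u) x <= PSeries (PS_decr_1 u) y).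
  { apply PSeries_nondecreasing; [exact Hu|lra|assumption]. }
  assert (H0y : PSeries (PS_decr_1 u) 0 <= PSeries (PS_decr_1 u) y).
  { apply PSeries_nondecreasing; [exact Hu|lra|assumption]. }
  rewrite PSeries_0 in H0y; unfold PS_decr_1 at 1 in H0y.
  nra.
Qed.

(** * Hypergeometric coefficients *)

Definition hyper_coef (a b c : R) (n : nat) : R :=
  shifted_fact a n * shifted_fact b n / shifted_fact c n / INR (fact n).

Lemma hyperF_PSeries (a b c x : R) : hyperF a b c x = PSeries (hyper_coef a b c) x.
Proof.
  unfold hyperF, PSeries; apply Series_ext; intros n.
  unfold hyper_coef, Rdiv; ring.
Qed.

Lemma hyper_coef_0 (a b c : R) : hyper_coef a b c 0 = 1.
Proof. unfold hyper_coef; simpl; field. Qed.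

Lemma hyperF_0 (a b c : R) : hyperF a b c 0 = 1.
Proof. now rewrite hyperF_PSeries, PSeries_0, hyper_coef_0. Qed.

Lemma shifted_fact_pos (a : R) (n : nat) : 0 < a -> 0 < shifted_fact a n.
Proof.
  intros Ha; induction n as [|n IH]; simpl; [lra|].
  pose proof (pos_INR n); apply Rmult_lt_0_compat; lra.
Qed.

Lemma shifted_fact_neq_0 (a : R) (n : nat) :
  (forall k, a + INR k <> 0) -> shifted_fact a n <> 0.
Proof.
  intros Ha; induction n as [|n IH]; simpl; [lra|].
  now apply Rmult_integral_contrapositive_currified.
Qed.

Lemma shifted_fact_S_l (a : R) (n : nat) :
  shifted_fact a (S n) = a * shifted_fact (a + 1) n.
Proof.
  induction n as [|n IH]; [simpl; ring|].
  change (shifted_fact a (S n) * (a + INR (S n))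
          = a * (shifted_fact (a + 1) n * (a + 1 + INR n))).
  rewrite IH, S_INR; ring.
Qed.

Lemma shifted_fact_1 (n : nat) : shifted_fact 1 n = INR (fact n).
Proof.
  induction n as [|n IH]; [reflexivity|].
  rewrite fact_simpl, mult_INR, S_INR, <- IH; simpl; ring.
Qed.

Lemma is_lim_seq_shift_ratio (a c : R) :
  (forall n, c + INR n <> 0) ->
  is_lim_seq (fun n => (a + INR n) / (c + INR n)) 1.
Proof.
  intros Hc.
  apply is_lim_seq_ext with (fun n => 1 + (a - c) * / (c + INR n)).
  { intros n; field; apply Hc. }
  replace (Finite 1) with (Finite (1 + (a - c) * 0)) by (f_equal; ring).
  apply is_lim_seq_plus'; [apply is_lim_seq_const|].
  apply is_lim_seq_mult'; [apply is_lim_seq_const|].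
  apply (is_lim_seq_inv _ p_infty); [|discriminate].
  apply (is_lim_seq_plus _ _ c p_infty).
  - apply is_lim_seq_const.
  - apply is_lim_seq_INR.
  - reflexivity.
Qed.

(** Ratio test: consecutive coefficients have ratio
    [(a+n)(b+n) / ((c+n)(1+n))], which tends to [1].  The parameters [a] and [b]
    are kept away from the nonpositive integers so that no coefficient
    vanishes and the ratio makes sense. *)
Lemma ex_pseries_hyper_coef (a b c x : R) :
  (forall n, a + INR n <> 0) -> (forall n, b + INR n <> 0) ->
  (forall n, c + INR n <> 0) -> Rabs x < 1 ->
  ex_pseries (hyper_coef a b c) x.
Proof.
  intros Ha Hb Hc Hx.
  assert (H1 : forall n, 1 + INR n <> 0) by (intros n; pose proof (pos_INR n); lra).
  apply CV_disk_correct, CV_disk_DAlembert with 1.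
  - intros n; unfold hyper_coef, Rdiv.
    repeat apply Rmult_integral_contrapositive_currified;
      try apply Rinv_neq_0_compat; try (now apply shifted_fact_neq_0).
    apply INR_fact_neq_0.
  - replace (Finite 1) with (Rbar_abs (Finite (1 * 1)))
      by (simpl; f_equal; rewrite Rmult_1_r; apply Rabs_R1).
    apply is_lim_seq_abs.
    apply is_lim_seq_ext with
      (fun n => (a + INR n) / (c + INR n) * ((b + INR n) / (1 + INR n))).
    + intros n; unfold hyper_coef.
      rewrite <- !shifted_fact_1; cbn [shifted_fact].
      field; repeat split; auto using shifted_fact_neq_0.
    + apply is_lim_seq_mult'; now apply is_lim_seq_shift_ratio.
  - right; split; lra.
Qed.

(** * Positive parameters *)

Lemma hyper_coef_pos (a b c : R) (n : nat) :
  0 < a -> 0 < b -> 0 < c -> 0 < hyper_coef a b c n.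
Proof.
  intros Ha Hb Hc; unfold hyper_coef.
  repeat apply Rdiv_lt_0_compat;
    [apply Rmult_lt_0_compat| |apply INR_fact_lt_0];
    now apply shifted_fact_pos.
Qed.

Lemma hyperF_increasing (a b c x y : R) :
  0 < a -> 0 < b -> 0 < c -> 0 <= x -> x < y -> y < 1 ->
  hyperF a b c x < hyperF a b c y.
Proof.
  intros Ha Hb Hc Hx Hxy Hy; rewrite !hyperF_PSeries.
  assert (Hex : forall z, 0 <= z < 1 -> ex_pseries (hyper_coef a b c) z).
  { intros z Hz; apply ex_pseries_hyper_coef;
      try (intros n; pose proof (pos_INR n); lra).
    apply Rabs_def1; lra. }
  apply PSeries_increasing; try (apply Hex; lra); [| |lra].
  - intros n; apply Rlt_le; now apply hyper_coef_pos.
  - now apply hyper_coef_pos.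
Qed.

Lemma hyperF_gt_1 (a b c x : R) :
  0 < a -> 0 < b -> 0 < c -> 0 < x < 1 -> 1 < hyperF a b c x.
Proof.
  intros Ha Hb Hc Hx; rewrite <- (hyperF_0 a b c).
  apply hyperF_increasing; lra.
Qed.

Lemma hyperF_root_of_power_bounds (a b c r p : R) :
  0 < a -> 0 < b -> 0 < c -> 0 < r < 1 -> 1 <= p ->
  Rpower (hyperF a b c (Rpower r p)) (1 / p) <= hyperF a b c r
  /\ hyperF a b c r <= Rpower (hyperF a b c (Rpower r (1 / p))) p.
Proof.
  intros Ha Hb Hc.
  apply root_of_power_bounds.
  - intros x; now apply hyperF_gt_1.
  - intros x y Hx; apply hyperF_increasing; lra.
Qed.

(** * Opposite parameters *)

(** Splitting off the first factors, [(-s)_(n+1) (s)_(n+1)] equals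
    [- s^2 (1-s)_n (1+s)_n], so adding the next coefficient multiplies the
    partial sum by [((n+1)^2 - s^2) / (n+1)^2], which is exactly the next factor
    of the right-hand side. *)
Lemma sum_hyper_coef_opp (s : R) (n : nat) :
  sum_f_R0 (hyper_coef (- s) s 1) n
  = shifted_fact (1 - s) n * shifted_fact (1 + s) n / INR (fact n) ^ 2.
Proof.
  induction n as [|n IH].
  - simpl; rewrite hyper_coef_0; field.
  - rewrite tech5, IH; unfold hyper_coef.
    rewrite shifted_fact_1, (shifted_fact_S_l (- s)), (shifted_fact_S_l s).
    replace (- s + 1) with (1 - s) by ring.
    replace (s + 1) with (1 + s) by ring.
    rewrite fact_simpl, mult_INR, S_INR; cbn [shifted_fact].
    pose proof (INR_fact_neq_0 n); pose proof (pos_INR n).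
    field; split; [assumption|lra].
Qed.

Lemma hyper_coef_opp_neg (s : R) (n : nat) :
  0 < s < 1 -> hyper_coef (- s) s 1 (S n) < 0.
Proof.
  intros Hs; unfold hyper_coef; rewrite shifted_fact_S_l.
  pose proof (shifted_fact_pos (- s + 1) n ltac:(lra)) as H1.
  pose proof (shifted_fact_pos s (S n) ltac:(lra)) as H2.
  pose proof (shifted_fact_pos 1 (S n) ltac:(lra)) as H3.
  pose proof (INR_fact_lt_0 (S n)) as H4.
  apply Ropp_lt_cancel; rewrite Ropp_0.
  replace (- _) with
    (s * shifted_fact (- s + 1) n * shifted_fact s (S n)
     / shifted_fact 1 (S n) / INR (fact (S n))) by (unfold Rdiv; ring).
  repeat apply Rdiv_lt_0_compat; try assumption.
  apply Rmult_lt_0_compat; [apply Rmult_lt_0_compat; lra|assumption].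
Qed.

Lemma ex_pseries_hyper_coef_opp (s x : R) :
  0 < s < 1 -> Rabs x < 1 -> ex_pseries (hyper_coef (- s) s 1) x.
Proof.
  intros Hs Hx; apply ex_pseries_hyper_coef; trivial;
    intros n; pose proof (pos_INR n); try lra.
  destruct n as [|n]; [simpl; lra|].
  rewrite S_INR; pose proof (pos_INR n); lra.
Qed.

(** Since [x^n <= x] for [n >= 1] and those coefficients are negative, a partial
    sum at [x] is at least [1 - x] plus [x] times the partial sum at [1], and
    the latter is positive. *)
Lemma hyperF_opp_lower_bound (s x : R) :
  0 < s < 1 -> 0 <= x < 1 -> 1 - x <= hyperF (- s) s 1 x.
Proof.
  intros Hs Hx; rewrite hyperF_PSeries.
  set (u := hyper_coef (- s) s 1).
  assert (Hcomb : forall n,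
    1 - x + x * sum_f_R0 u n <= sum_f_R0 (fun k => u k * x ^ k) n).
  { induction n as [|n IH].
    - unfold u; simpl; rewrite hyper_coef_0; lra.
    - rewrite !tech5.
      pose proof (hyper_coef_opp_neg s n Hs) as Hneg; fold u in Hneg.
      assert (Hpow : x ^ S n <= x).
      { rewrite <- (Rmult_1_r x) at 2; simpl.
        apply Rmult_le_compat_l; [lra|].
        rewrite <- (pow1 n); apply pow_incr; lra. }
      nra. }
  assert (Hpos : forall n, 0 <= sum_f_R0 u n).
  { intros n; unfold u; rewrite sum_hyper_coef_opp; apply Rlt_le.
    apply Rdiv_lt_0_compat; [|apply pow_lt, INR_fact_lt_0].
    apply Rmult_lt_0_compat; apply shifted_fact_pos; lra. }
  assert (Hex : ex_series (fun k => u k * x ^ k)).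
  { apply ex_pseries_R, ex_pseries_hyper_coef_opp; [assumption|].
    apply Rabs_def1; lra. }
  apply (is_lim_seq_le (fun _ => 1 - x) (sum_n (fun k => u k * x ^ k))
           (1 - x) (PSeries u x)).
  - intros n; rewrite sum_n_Reals.
    specialize (Hcomb n); specialize (Hpos n); nra.
  - apply is_lim_seq_const.
  - exact (Series_correct _ Hex).
Qed.

Lemma hyperF_opp_decreasing (s x y : R) :
  0 < s < 1 -> 0 <= x -> x < y -> y < 1 ->
  hyperF (- s) s 1 y < hyperF (- s) s 1 x.
Proof.
  intros Hs Hx Hxy Hy; rewrite !hyperF_PSeries.
  assert (Hex : forall z, 0 <= z < 1 ->
            ex_pseries (PS_opp (hyper_coef (- s) s 1)) z).
  { intros z Hz; apply ex_pseries_opp, ex_pseries_hyper_coef_opp;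
      [assumption|apply Rabs_def1; lra]. }
  apply Ropp_lt_cancel; rewrite <- !PSeries_opp.
  assert (Hpos : forall n, 0 < PS_opp (hyper_coef (- s) s 1) (S n)).
  { intros n; pose proof (hyper_coef_opp_neg s n Hs).
    unfold PS_opp; change opp with Ropp; simpl in *; lra. }
  apply PSeries_increasing; try (apply Hex; lra); [| |lra].
  - intros n; now apply Rlt_le.
  - apply Hpos.
Qed.

(** The reciprocal of this function increases and exceeds [1], so it obeys the
    general bounds; inverting them exchanges the two sides. *)
Lemma hyperF_opp_root_of_power_bounds (s r p : R) :
  0 < s < 1 -> 0 < r < 1 -> 1 <= p ->
  Rpower (hyperF (- s) s 1 (Rpower r (1 / p))) p <= hyperF (- s) s 1 r
  /\ hyperF (- s) s 1 r <= Rpower (hyperF (- s) s 1 (Rpower r p)) (1 / p).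
Proof.
  intros Hs Hr Hp.
  set (G := hyperF (- s) s 1).
  assert (Hpos : forall x, 0 < x < 1 -> 0 < G x).
  { intros x Hx; pose proof (hyperF_opp_lower_bound s x Hs ltac:(lra)).
    unfold G; lra. }
  assert (Hdecr : forall x y, 0 <= x -> x < y -> y < 1 -> G y < G x).
  { intros x y; now apply hyperF_opp_decreasing. }
  assert (HG0 : G 0 = 1) by apply hyperF_0.
  assert (Hip : 0 < 1 / p) by (apply Rdiv_lt_0_compat; lra).
  pose proof (Hpos _ (Rpower_inside_unit r p Hr ltac:(lra))) as Gp.
  pose proof (Hpos _ (Rpower_inside_unit r (1 / p) Hr Hip)) as Gip.
  pose proof (Hpos r Hr) as Gr.
  destruct (root_of_power_bounds (fun x => / G x)) with (r := r) (p := p)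
    as [L U]; try assumption.
  - intros x Hx; rewrite <- Rinv_1; apply Rinv_lt_contravar.
    + rewrite Rmult_1_r; now apply Hpos.
    + rewrite <- HG0; apply Hdecr; lra.
  - intros x y Hx Hxy Hy; apply Rinv_lt_contravar.
    + apply Rmult_lt_0_compat; apply Hpos; lra.
    + apply Hdecr; lra.
  - rewrite Rpower_inv_base in L, U by assumption.
    split; apply Rinv_le_cancel_pos; assumption || apply exp_pos.
Qed.

(** * The generalized elliptic integrals *)

Theorem theorem1p5 :
  (forall a b c r : R, 0 < a -> 0 < b -> 0 < c -> 0 < r < 1 ->
     forall p q : R, 0 < p -> p < q ->
       Rpower (hyperF a b c (Rpower r q)) (1 / q)
         < Rpower (hyperF a b c (Rpower r p)) (1 / p))
  /\
  (forall p : R, 1 <= p ->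
     (forall a b c r : R, 0 < a -> 0 < b -> 0 < c -> 0 < r < 1 ->
        Rpower (hyperF a b c (Rpower r p)) (1 / p) <= hyperF a b c r
        /\ hyperF a b c r <= Rpower (hyperF a b c (Rpower r (1 / p))) p)
     /\
     (forall a r : R, 0 < a <= 1 / 2 -> 0 < r < 1 ->
        Rpower (PI / 2) (1 - 1 / p) * Rpower (ellK a (Rpower r p)) (1 / p)
          <= ellK a r
        /\ ellK a r
          <= Rpower (PI / 2) (1 - p) * Rpower (ellK a (Rpower r (1 / p))) p)
     /\
     (forall a r : R, 0 < a <= 1 / 2 -> 0 < r < 1 ->
        Rpower (PI / 2) (1 - p) * Rpower (ellE a (Rpower r (1 / p))) p
          <= ellE a r
        /\ ellE a r
          <= Rpower (PI / 2) (1 - 1 / p) * Rpower (ellE a (Rpower r p)) (1 / p))).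
Proof.
  assert (Hpi : 0 < PI / 2) by (pose proof PI_RGT_0; lra).
  split; [|intros p Hp; split; [|split]].
  - intros a b c r Ha Hb Hc Hr p q.
    apply root_of_power_decreasing; [| |assumption].
    + intros x; now apply hyperF_gt_1.
    + intros x y Hx; apply hyperF_increasing; lra.
  - intros a b c r Ha Hb Hc Hr; now apply hyperF_root_of_power_bounds.
  - intros a r Ha Hr; unfold ellK.
    assert (Hr2 : 0 < r ^ 2 < 1) by (simpl; nra).
    assert (Hip : 0 < 1 / p) by (apply Rdiv_lt_0_compat; lra).
    assert (Hpos : forall t, 0 < t ->
              0 < hyperF a (1 - a) 1 (Rpower (r ^ 2) t)).
    { intros t Ht; apply Rlt_trans with 1; [lra|].
      apply hyperF_gt_1; try lra; now apply Rpower_inside_unit. }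
    rewrite !Rpower_sqr_comm by lra.
    rewrite !Rpower_normalized by (assumption || apply Hpos; lra).
    destruct (hyperF_root_of_power_bounds a (1 - a) 1 (r ^ 2) p) as [L U];
      try lra.
    split; apply Rmult_le_compat_l; lra.
  - intros a r Ha Hr; unfold ellE.
    assert (Hr2 : 0 < r ^ 2 < 1) by (simpl; nra).
    assert (Hip : 0 < 1 / p) by (apply Rdiv_lt_0_compat; lra).
    replace (a - 1) with (- (1 - a)) by ring.
    assert (Hpos : forall t, 0 < t ->
              0 < hyperF (- (1 - a)) (1 - a) 1 (Rpower (r ^ 2) t)).
    { intros t Ht; pose proof (Rpower_inside_unit (r ^ 2) t Hr2 Ht).
      apply Rlt_le_trans with (1 - Rpower (r ^ 2) t); [lra|].
      apply hyperF_opp_lower_bound; lra. }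
    rewrite !Rpower_sqr_comm by lra.
    rewrite !Rpower_normalized by (assumption || apply Hpos; lra).
    destruct (hyperF_opp_root_of_power_bounds (1 - a) (r ^ 2) p) as [L U];
      try lra.
    split; apply Rmult_le_compat_l; lra.
Qed.
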